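(* Let $\boldsymbol\alpha\in\mathbb{N}^m$, $\boldsymbol\beta\in\mathbb{N}^n$, let $K=(k_{ij})$ be an $m\times n$ matrix with entries in $\mathbb{N}$, and $s\in[0,1]$. Then \[ \mathrm{cap}_{\boldsymbol\alpha\,\boldsymbol\beta}(Q_{K,s})=\sup_{M}\ \prod_{i=1}^m\prod_{j=1}^n\frac{k_{ij}^{k_{ij}}\,s^{m_{ij}}(1-s)^{k_{ij}-m_{ij}}}{m_{ij}^{m_{ij}}(k_{ij}-m_{ij})^{k_{ij}-m_{ij}}}, \] where the supremum is over all real $m\times n$ matrices $M=(m_{ij})$ with $0\le m_{ij}\le k_{ij}$ for all $i,j$, row sums $\sum_j m_{ij}=\alpha_i$ and column sums $\sum_i m_{ij}=\beta_j$.
   Context: $Q_{K,s}(\mathbf{x},\mathbf{y})=\prod_{i=1}^m\prod_{j=1}^n(s\,x_iy_j+(1-s))^{k_{ij}}$, and $\mathrm{cap}_{\boldsymbol\alpha\,\boldsymbol\beta}(F)=\inf_{\mathbf{x}>0,\mathbf{y}>0}F(\mathbf{x},\mathbf{y})\prod_i x_i^{-\alpha_i}\prod_j y_j^{-\beta_j}$. Convention $0^0=1$. *)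

(* Defs.v *)
From HB Require Import structures.
From mathcomp Require Import all_boot all_order all_algebra.
From mathcomp Require Import all_classical all_reals all_analysis.

Set Implicit Arguments.
Unset Strict Implicit.
Unset Printing Implicit Defensive.

Import Order.TTheory GRing.Theory Num.Theory.
Local Open Scope classical_set_scope.
Local Open Scope ring_scope.

(* Both [x ^+ n] (natural exponent) and [x `^ r] (real exponent) take the value
   1 at (0, 0), and 0 `^ r = 0 for r != 0. *)

Section Capacity.
Context {R : realType} {m n : nat}.
Implicit Types (K : 'M[nat]_(m, n)) (s : R).
Implicit Types (alpha : 'rV[nat]_m) (beta : 'rV[nat]_n).

Definition pos_vec {p : nat} (x : 'rV[R]_p) : Prop := forall i, 0 < x ord0 i.

Definition Q K s (x : 'rV[R]_m) (y : 'rV[R]_n) : R :=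
  \prod_(i < m) \prod_(j < n)
    (s * (x ord0 i * y ord0 j) + (1 - s)) ^+ K i j.

(* [x ^- a] is (x ^+ a)^-1.  For F nonnegative on positive vectors, the set
   below is nonempty and bounded below by 0, so [inf] is the true infimum. *)
Definition capacity alpha beta (F : 'rV[R]_m -> 'rV[R]_n -> R) : R :=
  inf [set z | exists x y, [/\ pos_vec x, pos_vec y &
    z = F x y * \prod_(i < m) x ord0 i ^- alpha ord0 i
              * \prod_(j < n) y ord0 j ^- beta ord0 j]].

Definition feasible K alpha beta : set 'M[R]_(m, n) :=
  [set M | [/\ forall i j, 0 <= M i j <= (K i j)%:R,
               forall i, \sum_(j < n) M i j = (alpha ord0 i)%:R &
               forall j, \sum_(i < m) M i j = (beta ord0 j)%:R]].

Definition objective K s (M : 'M[R]_(m, n)) : R :=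
  \prod_(i < m) \prod_(j < n)
    (((K i j)%:R ^+ K i j * s `^ M i j * (1 - s) `^ ((K i j)%:R - M i j))
     / (M i j `^ M i j * ((K i j)%:R - M i j) `^ ((K i j)%:R - M i j))).

End Capacity.

(* Main.v *)
Require Import Defs.
From HB Require Import structures.
From mathcomp Require Import all_boot all_order all_algebra.
From mathcomp Require Import all_classical all_reals all_analysis.
From mathcomp Require Import ring lra.

Import Order.TTheory GRing.Theory Num.Theory.
Import numFieldNormedType.Exports.
Local Open Scope classical_set_scope.
Local Open Scope ring_scope.

(* With [x = exp a], [y = exp b] the capacity becomes the exponential of the
   infimum of the convex function
     f(a, b) = sum_ij k_ij ln (s exp (a_i + b_j) + 1 - s) - <alpha, a> - <beta, b>.
   That every feasible [M] gives a lower bound is AM-GM in each factor, with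
   equality at the tilted mean m_ij = k_ij s e^t / (s e^t + 1 - s), t = a_i + b_j,
   which is also the derivative of the (i, j) summand of f.  The infimum need not
   be attained, so for eps > 0 one minimises f + eps/2 |(a, b)|^2 instead.  At a
   minimiser the tilted means have line sums alpha_i - eps a_i and
   beta_j - eps b_j, and objective at least exp f >= cap.  When cap > 0, f is
   bounded below, so eps |(a, b)|^2 stays bounded and the errors in the line sums
   vanish with eps; compactness of the box of matrices then gives a feasible
   matrix with objective at least cap. *)

(** * Continuity, derivatives and minima for finite families of reals *)

Section FiniteFamilies.
Context {R : realType}.

Lemma continuous_fsum (T : topologicalType) (J : finType) (F : J -> T -> R) :
  (forall j, continuous (F j)) -> continuous (fun x => \sum_j F j x).
Proof.
by move=> cF; apply: continuous_big => [|j _]; [exact: add_continuous|exact: cF].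
Qed.

(** The product topology makes boxes compact by Tychonoff and coordinates continuous. *)
Definition coord_space (J : finType) : topologicalType :=
  prod_topology (fun _ : J => R).

Lemma continuous_cstM (T : topologicalType) (a : R) (f : T -> R) :
  continuous f -> continuous (fun x => a * f x).
Proof. by move=> cf x; apply: cvgMl_tmp; exact: cf. Qed.

Lemma continuous_addf (T : topologicalType) (f h : T -> R) :
  continuous f -> continuous h -> continuous (fun x => f x + h x).
Proof. by move=> cf ch x; apply: cvgD; [exact: cf|exact: ch]. Qed.

Lemma continuous_subf (T : topologicalType) (f h : T -> R) :
  continuous f -> continuous h -> continuous (fun x => f x - h x).
Proof. by move=> cf ch x; apply: cvgB; [exact: cf|exact: ch]. Qed.

Lemma continuous_sqr (T : topologicalType) (f : T -> R) :
  continuous f -> continuous (fun x => f x ^+ 2).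
Proof. by move=> cf x; apply: (@cvgM _ _ _ _ f f); exact: cf. Qed.

Lemma is_derive_fsum (J : finType) (F : J -> R -> R) (dF : J -> R) (t : R) :
  (forall j, is_derive t 1 (F j) (dF j)) ->
  is_derive t 1 (fun t => \sum_j F j t) (\sum_j dF j).
Proof.
move=> dFj; elim: (index_enum J) => [|j r IHr].
  rewrite big_nil; under eq_fun do rewrite big_nil; exact: is_derive_cst.
by rewrite big_cons; under eq_fun do rewrite big_cons; exact: is_deriveD.
Qed.

Lemma is_derive_affine (a b t : R) : is_derive t 1 (fun u => a + u * b) b.
Proof.
by apply: is_derive_eq; rewrite scaler0 !add0r mul1r; exact: mulr1.
Qed.

Lemma is_derive_quadratic (e a b t : R) :
  is_derive t 1 (fun u => e * (a + u * (b + u))) (e * (b + t *+ 2)).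
Proof.
by apply: is_derive_eq; rewrite /GRing.scale/=; ring.
Qed.

Lemma is_derive_cstM (a t df : R) (f : R -> R) :
  is_derive t 1 f df -> is_derive t 1 (fun u => a * f u) (a * df).
Proof. exact: is_deriveZ. Qed.

Lemma box_EVT_min (J : finType) (lo hi : J -> R) (f : (J -> R) -> R) :
  (forall j, lo j <= hi j) ->
  continuous (f : coord_space J -> R) ->
  exists2 c, forall j, lo j <= c j <= hi j &
    forall c', (forall j, lo j <= c' j <= hi j) -> f c <= f c'.
Proof.
move=> lohi cf; pose B : set (coord_space J) :=
  [set c | forall j, `[lo j, hi j]%classic (c j)].
have cB : compact B.
  exact: (@tychonoff J (fun=> R) (fun j => `[lo j, hi j]%classic)
    (fun j => @segment_compact R (lo j) (hi j))).
have [||c] := @compact_EVT_min (coord_space J) R f B _ cB.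
- by exists lo => j /=; rewrite in_itv/= lexx lohi.
- exact: continuous_subspaceT.
rewrite inE => Bc minc; exists c.
  by move=> j; have := Bc j; rewrite /= in_itv.
by move=> c' Bc'; apply: minc; rewrite inE => j /=; rewrite in_itv/= Bc'.
Qed.

End FiniteFamilies.

(** * One factor: its logarithm, its tilted mean and the AM-GM inequality *)

Section Factor.
Context {R : realType}.
Implicit Types s t k m u v x : R.

Definition bernoulli_mgf s t := s * expR t + (1 - s).

(** For [0 < s < 1], [0 < k] and [0 <= m <= k] this is [- k] times the relative entropy of the
    Bernoulli law of mean [m / k] with respect to that of mean [s]. *)
Definition factor_entropy s k m :=
  k * ln k + m * ln s + (k - m) * ln (1 - s) - m * ln m - (k - m) * ln (k - m).

Definition tilted_mean s k t := k * (s * expR t / bernoulli_mgf s t).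

Definition cap_factor s (k : nat) m :=
  (k%:R ^+ k * s `^ m * (1 - s) `^ (k%:R - m))
    / (m `^ m * (k%:R - m) `^ (k%:R - m)).

(* Since [ln 0 = 0], [expR (factor_entropy s k m)] is the wrong value when
   [s = 0 < m] or [s = 1], [m < k]; the true factor is then 0. *)
Definition factor_dom s k m :=
  [/\ 0 <= m, m <= k, s = 0 -> m = 0 & s = 1 -> m = k].

(** At [u = 0] the exponential is 1, because [ln 0 = 0], while the power is 1 only for [x = 0]. *)
Lemma powR_expR u x : (u = 0 -> x = 0) -> u `^ x = expR (x * ln u).
Proof.
move=> ux; rewrite /powR; case: eqP => // u0.
by rewrite (ux u0) eqxx mul0r expR0.
Qed.

Lemma natr_exp_expR (k : nat) : k%:R ^+ k = expR (k%:R * ln k%:R) :> R.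
Proof.
by rewrite -powR_mulrn ?ler0n// powR_expR.
Qed.

Lemma cap_factorE s (k : nat) m : factor_dom s k%:R m ->
  cap_factor s k m = expR (factor_entropy s k%:R m).
Proof.
case=> m0 mk s0 s1; rewrite /cap_factor /factor_entropy natr_exp_expR.
have s1' : 1 - s = 0 -> k%:R - m = 0.
  by move=> /eqP; rewrite subr_eq0 eq_sym => /eqP/s1 ->; rewrite subrr.
rewrite (powR_expR _ _ s0) (powR_expR _ _ s1').
rewrite (powR_expR m m)// (powR_expR (k%:R - m))//.
by rewrite invfM -!expRN !mulrA -!expRD.
Qed.

Lemma cap_factor_eq0 s (k : nat) m : 0 <= m <= k%:R -> ~ factor_dom s k%:R m ->
  cap_factor s k m = 0.
Proof.
move=> /andP[m0 mk] nd; rewrite /cap_factor.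
have [/andP[/eqP s0 mN0]|/negP h0] := boolP ((s == 0) && (m != 0)).
  by rewrite s0 (powR0 mN0) mulr0 !mul0r.
have [/andP[/eqP s1 mNk]|/negP h1] := boolP ((s == 1) && (m != k%:R)).
  by rewrite s1 subrr (powR0 (x := _ - m)) ?mulr0 ?mul0r// subr_eq0 eq_sym.
exfalso; apply: nd; split=> //.
- by move=> s0; apply/eqP/negP => /negP mN0; apply: h0; rewrite s0 eqxx.
- by move=> s1; apply/eqP/negP => /negP mN0; apply: h1; rewrite s1 eqxx.
Qed.

Lemma cap_factor_ge0 s (k : nat) m : 0 <= cap_factor s k m.
Proof. by rewrite /cap_factor !mulr_ge0 ?invr_ge0 ?mulr_ge0 ?powR_ge0 ?exprn_ge0. Qed.

(** This is [u] times the tangent bound ln(v/u) <= v/u - 1. The case [v = 0 < u] is excluded, since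
    there the convention [ln 0 = 0] can break the bound. *)
Lemma gibbs_term u v : 0 <= u -> 0 <= v -> (v = 0 -> u = 0) ->
  u * ln v - u * ln u <= v - u.
Proof.
move=> u0 v0 vu; have [->|uN0] := eqVneq u 0; first by rewrite !mul0r !subr0.
have up : 0 < u by rewrite lt_neqAle eq_sym uN0.
have vp : 0 < v.
  rewrite lt_neqAle v0 andbT; apply/eqP => /esym/vu ue; by rewrite ue eqxx in uN0.
rewrite -mulrBr -ln_div ?posrE//.
have := @le_ln1Dx R (v / u - 1).
rewrite ltrBrDl subrr divr_gt0// addrC subrK => /(_ isT).
rewrite -(ler_pM2l up) => /le_trans; apply.
by rewrite mulrBr mulr1 mulrCA divff ?mulr1.
Qed.

Section UnitInterval.
Context {s : R} (hs : 0 <= s <= 1).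

Lemma bernoulli_mgf_gt0 t : 0 < bernoulli_mgf s t.
Proof.
have /andP[s0 s1] := hs; rewrite /bernoulli_mgf.
have [->|sN1] := eqVneq s 1; first by rewrite mul1r subrr addr0 expR_gt0.
by rewrite ltr_wpDl ?mulr_ge0 ?expR_ge0// subr_gt0 lt_neqAle sN1.
Qed.

Lemma tilted_meanC k t :
  k - tilted_mean s k t = k * ((1 - s) / bernoulli_mgf s t).
Proof.
rewrite /tilted_mean; have /lt0r_neq0 := bernoulli_mgf_gt0 t.
move=> z0; rewrite -{1}(mulr1 k) -{1}(divff z0) -mulrBr -mulrBl.
by congr (_ * (_ / _)); rewrite /bernoulli_mgf addrC addKr.
Qed.

Lemma tilted_mean_dom k t : 0 <= k -> factor_dom s k (tilted_mean s k t).
Proof.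
have /andP[s0 s1] := hs; have z0 := bernoulli_mgf_gt0 t; move=> k0; split.
- by rewrite /tilted_mean !mulr_ge0 ?expR_ge0// invr_ge0 ltW.
- by rewrite -subr_ge0 tilted_meanC !mulr_ge0 ?subr_ge0// invr_ge0 ltW.
- by move=> s_eq; rewrite /tilted_mean s_eq !(mul0r,mulr0).
- move=> s_eq; apply/eqP; rewrite eq_sym -subr_eq0 tilted_meanC s_eq.
  by rewrite subrr mul0r mulr0.
Qed.

Let mul_lnM u v x : 0 <= v -> 0 <= x -> (v * x = 0 -> u = 0) ->
  u * ln (v * x) = u * ln v + u * ln x.
Proof.
move=> v0 x0; have [->|uN0] := eqVneq u 0; first by rewrite !mul0r addr0.
move=> h; have : v * x != 0 by apply/eqP => /h/eqP; rewrite (negPf uN0).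
rewrite mulf_eq0 negb_or => /andP[vN0 xN0].
by rewrite lnM ?mulrDr// posrE lt_neqAle eq_sym ?vN0 ?xN0.
Qed.

(* The logarithmic deficit in the AM-GM inequality splits into two Gibbs
   terms, one for each side of the Bernoulli variable. *)
Lemma factor_entropy_split k m t : 0 <= k -> factor_dom s k m ->
  factor_entropy s k m + t * m - k * ln (bernoulli_mgf s t) =
    (m * ln (tilted_mean s k t) - m * ln m) +
    ((k - m) * ln (k - tilted_mean s k t) - (k - m) * ln (k - m)).
Proof.
have /andP[s0 s1] := hs; move=> k0 [m0 mk sm0 sm1].
have z0 := bernoulli_mgf_gt0 t; have z0' : 0 <= (bernoulli_mgf s t)^-1.
  by rewrite invr_ge0 ltW.
have s1' : 0 <= 1 - s by rewrite subr_ge0.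
rewrite tilted_meanC /tilted_mean.
have km0 : k = 0 -> m = 0 by move=> kE; apply/eqP; rewrite eq_le m0 -kE mk.
have lnz : ln (bernoulli_mgf s t)^-1 = - ln (bernoulli_mgf s t) by rewrite lnV.
rewrite (mul_lnM m k) ?mulr_ge0 ?expR_ge0//; last first.
  move/eqP; rewrite !mulf_eq0 invr_eq0 (gt_eqF z0) (gt_eqF (expR_gt0 _)) !orbF.
  by case/orP=> /eqP.
rewrite (mul_lnM m (s * _)) ?mulr_ge0 ?expR_ge0//; last first.
  move/eqP; rewrite !mulf_eq0 invr_eq0 (gt_eqF z0) (gt_eqF (expR_gt0 _)) !orbF.
  by move=> /eqP.
rewrite (mul_lnM m s) ?expR_ge0//; last first.
  by move/eqP; rewrite !mulf_eq0 (gt_eqF (expR_gt0 _)) orbF => /eqP.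
have sk : 1 - s = 0 -> k - m = 0.
  by move=> /eqP; rewrite subr_eq0 eq_sym => /eqP/sm1 ->; rewrite subrr.
rewrite (mul_lnM (k - m) k) ?mulr_ge0//; last first.
  move/eqP; rewrite !mulf_eq0 invr_eq0 (gt_eqF z0) !orbF.
  by case/orP=> /eqP // kE; rewrite (km0 kE) kE subrr.
rewrite (mul_lnM (k - m) (1 - s)) ?mulr_ge0//; last first.
  by move/eqP; rewrite !mulf_eq0 invr_eq0 (gt_eqF z0) !orbF => /eqP.
rewrite lnz expRK /factor_entropy; ring.
Qed.

(** With p the tilted mean, the two Gibbs terms are at most p - m and (k - p) - (k - m), which
    cancel. *)
Lemma factor_entropy_le k m t : 0 <= k -> factor_dom s k m ->
  factor_entropy s k m + t * m <= k * ln (bernoulli_mgf s t).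
Proof.
have /andP[s0 s1] := hs; move=> k0 dm; have [m0 mk sm0 sm1] := dm.
rewrite -subr_le0 factor_entropy_split//.
have [p0 pk _ _] := tilted_mean_dom k t k0; have z0 := bernoulli_mgf_gt0 t.
have km0 : k = 0 -> m = 0 by move=> kE; apply/eqP; rewrite eq_le m0 -kE mk.
have h1 := @gibbs_term m (tilted_mean s k t) m0 p0.
have h2 := @gibbs_term (k - m) (k - tilted_mean s k t).
apply: (@le_trans _ _ ((tilted_mean s k t - m)
  + ((k - tilted_mean s k t) - (k - m)))); last by lra.
apply: lerD; [apply: h1|apply: h2]; rewrite ?subr_ge0//.
- move/eqP; rewrite /tilted_mean !mulf_eq0 invr_eq0 (gt_eqF z0).
  by rewrite (gt_eqF (expR_gt0 _)) !orbF => /orP[]/eqP.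
- rewrite tilted_meanC => /eqP; rewrite !mulf_eq0 invr_eq0 (gt_eqF z0) orbF.
  case/orP=> /eqP; first by move=> kE; rewrite (km0 kE) kE subrr.
  by move=> /eqP; rewrite subr_eq0 eq_sym => /eqP/sm1 ->; rewrite subrr.
Qed.

(** Equality case: both Gibbs terms vanish when [m] is the tilted mean. *)
Lemma factor_entropy_tilted k t : 0 <= k ->
  factor_entropy s k (tilted_mean s k t) + t * tilted_mean s k t =
  k * ln (bernoulli_mgf s t).
Proof.
move=> k0; apply/eqP; rewrite -subr_eq0 factor_entropy_split//.
  by rewrite !subrr addr0.
exact: tilted_mean_dom.
Qed.

Lemma continuous_ln_bernoulli_mgf :
  continuous (fun t : R => ln (bernoulli_mgf s t)).
Proof.
move=> t; apply: (@continuous_comp _ _ _ (bernoulli_mgf s) (@ln R)).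
  apply: cvgD; last exact: cvg_cst.
  by apply: cvgMl_tmp; exact: continuous_expR.
by apply: continuous_ln; exact: bernoulli_mgf_gt0.
Qed.

Lemma is_derive_ln_bernoulli_mgf l a t :
  is_derive t 1 (fun t : R => ln (bernoulli_mgf s (l + t * a)))
    (a * (s * expR (l + t * a) / bernoulli_mgf s (l + t * a))).
Proof.
have z0 := bernoulli_mgf_gt0 (l + t * a).
have h1 := is_derive_affine l a t.
have h2 : is_derive t 1 (fun t : R => expR (l + t * a)) (a * expR (l + t * a)).
  have h := @is_derive1_comp R expR _ t _ _ (is_derive_expR (l + t * a)) h1.
  by apply: (is_derive_eq h); rewrite mulrC.
have h3 : is_derive t 1 (fun t : R => bernoulli_mgf s (l + t * a))
    (a * (s * expR (l + t * a))).
  rewrite /bernoulli_mgf; apply: is_derive_eq.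
  by rewrite !addr0; exact: mulrCA.
have := @is_derive1_comp R (@ln R) _ t _ _ (is_derive1_ln z0) h3.
by move=> h; apply: (is_derive_eq h); rewrite mulrC !mulrA.
Qed.

End UnitInterval.

(** For [0 < x], putting r = sqrt x reduces the claim to r * (- ln r) <= 1, which follows from
    ln(1/r) < 1/r. *)
Lemma norm_mul_ln_le x : x < 1 -> `|x * ln x| <= 2 * Num.sqrt `|x|.
Proof.
move=> x1; have [x0|x0] := leP x 0.
  by rewrite ln0// mulr0 normr0 mulr_ge0 ?sqrtr_ge0.
rewrite ler0_norm; last by rewrite mulr_ge0_le0 ?(ltW x0)// ln_le0// ltW.
rewrite (gtr0_norm x0); set r := Num.sqrt x.
have r0 : 0 < r by rewrite sqrtr_gt0.
have xE : x = r ^+ 2 by rewrite sqr_sqrtr// ltW.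
have := @ln_sublinear R r^-1; rewrite invr_gt0 r0 => /(_ isT)/ltW.
rewrite lnV// => h; rewrite xE lnXn// -mulrN -mulNrn.
have -> : r ^+ 2 * (- ln r *+ 2) = 2 * r * (r * - ln r) by ring.
rewrite -[leRHS]mulr1 ler_pM2l ?mulr_gt0//.
by rewrite -[leRHS](divff (lt0r_neq0 r0)) ler_pM2l.
Qed.

Lemma continuous_mul_ln : continuous (fun x : R => x * ln x).
Proof.
move=> x; have [x0|x0|->] := ltgtP x 0.
- rewrite /continuous_at (ln0 (ltW x0)) mulr0; apply: cvg_near_cst.
  by near=> y; rewrite ln0 ?mulr0// ltW//; near: y; exact: lt_nbhsl.
- apply: cvgM; first exact: cvg_id.
  exact: continuous_ln.
- rewrite /continuous_at mul0r; apply/norm_cvg0P.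
  apply: (@squeeze_cvgr _ _ _ _ (cst 0) (fun x => 2 * Num.sqrt `|x|)).
  + near=> y; rewrite normr_ge0/= norm_mul_ln_le//.
    by near: y; apply: lt_nbhsl.
  + exact: cvg_cst.
  + have : 2 * Num.sqrt `|x| @[x --> (0 : R)] --> 2 * Num.sqrt `|0 : R|.
      apply: cvgMl_tmp.
      apply: (@continuous_comp _ _ _ (fun x : R => `|x|) Num.sqrt).
        exact: norm_continuous.
      exact: sqrt_continuous.
    by rewrite normr0 sqrtr0 mulr0.
Unshelve. all: by end_near.
Qed.

End Factor.

(** * Entropy maximisation under linear constraints, and its dual *)

Section Duality.
Context {R : realType} {I E : finType}.
Local Notation coord_space := (@coord_space R).
Context {s : R} (hs : 0 <= s <= 1).
(** [E] indexes the factors and [I] the linear constraints, with coefficients [A] and prescribed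
    values [g]; row and column sums are thus treated alike. *)
Variables (A : E -> I -> R) (k : E -> nat) (g : I -> R).
Implicit Types (c : I -> R) (M : E -> R).

Definition linform c e := \sum_i A e i * c i.

Definition log_potential c :=
  \sum_e (k e)%:R * ln (bernoulli_mgf s (linform c e)) - \sum_i g i * c i.

Definition marginal M i := \sum_e A e i * M e.

Definition entropy M := \sum_e factor_entropy s (k e)%:R (M e).

Definition tilting c e := tilted_mean s (k e)%:R (linform c e).

Lemma sum_linform M c :
  \sum_e linform c e * M e = \sum_i marginal M i * c i.
Proof.
rewrite /linform /marginal; under eq_bigr do rewrite mulr_suml.
rewrite exchange_big/=; apply: eq_bigr => i _; rewrite mulr_suml.
by apply: eq_bigr => e _; ring.
Qed.

(** Weak duality. The constraints rewrite the linear term of the potential as a sum over factors, so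
    the inequality splits factor by factor; outside [factor_dom] the left factor is 0. *)
Lemma prod_factor_le M c : (forall e, 0 <= M e <= (k e)%:R) ->
  (forall i, marginal M i = g i) ->
  \prod_e cap_factor s (k e) (M e) <= expR (log_potential c).
Proof.
move=> hM gM; have -> : log_potential c =
    \sum_e ((k e)%:R * ln (bernoulli_mgf s (linform c e)) - linform c e * M e).
  rewrite sumrB sum_linform /log_potential; congr (_ - _).
  by apply: eq_bigr => i _; rewrite gM.
rewrite expR_sum; apply: ler_prod => e _; rewrite cap_factor_ge0/=.
have [dom|ndom] := pselect (factor_dom s (k e)%:R (M e)); last first.
  by rewrite (cap_factor_eq0 _ _ _ (hM e) ndom) expR_ge0.
by rewrite cap_factorE// ler_expR lerBrDr factor_entropy_le.
Qed.

(** Sum of the equality cases; the last term is the price of marginals different from [g]. *)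
Lemma entropy_tilting c : entropy (tilting c) =
  log_potential c + \sum_i (g i - marginal (tilting c) i) * c i.
Proof.
under [in RHS]eq_bigr do rewrite mulrBl.
rewrite sumrB -sum_linform addrA /log_potential subrK -sumrB.
apply: eq_bigr => e _.
by rewrite -(factor_entropy_tilted hs)// addrK.
Qed.

(** Moving one coordinate reduces partial derivatives to one real variable. *)
Let shift c i t : I -> R := fun j => c j + t * (j == i)%:R.

Let sum_shift (F : I -> R) c i t :
  \sum_j F j * shift c i t j = \sum_j F j * c j + t * F i.
Proof.
rewrite /shift; under eq_bigr do rewrite mulrDr mulrCA.
rewrite big_split/= -mulr_sumr; congr (_ + _ * _).
by rewrite (bigD1 i)//= eqxx mulr1 big1 ?addr0// => j /negPf->; rewrite mulr0.
Qed.

Let sum_shift2 c i t :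
  \sum_j shift c i t j ^+ 2 = \sum_j c j ^+ 2 + t * (c i *+ 2 + t).
Proof.
rewrite (bigD1 i)//= [in RHS](bigD1 i)//= /shift eqxx mulr1.
rewrite (eq_bigr (fun j => c j ^+ 2)) => [|j /negPf->]; first by ring.
by rewrite mulr0 addr0.
Qed.

Definition ridge eps c := log_potential c + eps / 2 * \sum_i c i ^+ 2.

Lemma continuous_ridge eps :
  continuous (ridge eps : coord_space I -> R).
Proof.
have cproj i : continuous (fun c : coord_space I => c i).
  exact: (@proj_continuous I (fun=> R) i).
have clin (F : I -> R) :
    continuous (fun c : coord_space I => \sum_i F i * c i).
  exact (@continuous_fsum R (coord_space I) I (fun i c => F i * c i)
    (fun i => @continuous_cstM R (coord_space I) (F i) (fun c => c i) (cproj i))).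
have cln e : continuous (fun c : coord_space I =>
    ln (bernoulli_mgf s (linform c e))).
  move=> c; apply: (@continuous_comp _ _ _
    (fun c : coord_space I => linform c e)
    (fun t => ln (bernoulli_mgf s t))); first exact: (clin (A e)).
  exact: continuous_ln_bernoulli_mgf.
have cpot := @continuous_fsum R (coord_space I) E
  (fun e c => (k e)%:R * ln (bernoulli_mgf s (linform c e)))
  (fun e => @continuous_cstM R (coord_space I) (k e)%:R _ (cln e)).
have csq := @continuous_fsum R (coord_space I) I (fun i c => c i ^+ 2)
  (fun i => @continuous_sqr R (coord_space I) (fun c => c i) (cproj i)).
exact (@continuous_addf R (coord_space I) _ _
  (@continuous_subf R (coord_space I) _ _ cpot (clin g))
  (@continuous_cstM R (coord_space I) (eps / 2) _ csq)).
Qed.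

(** The difference of the two sides is the [i]-th partial derivative of [ridge eps], which vanishes
    at a minimiser. *)
Lemma ridge_min_critical eps c : (forall c', ridge eps c <= ridge eps c') ->
  forall i, marginal (tilting c) i = g i - eps * c i.
Proof.
move=> minc i.
have dphi (t : R) : is_derive t 1 (fun t => ridge eps (shift c i t))
   (\sum_e (k e)%:R * (A e i * (s * expR (linform c e + t * A e i) /
      bernoulli_mgf s (linform c e + t * A e i))) - g i + eps * (c i + t)).
  under eq_fun => u.
    rewrite /ridge /log_potential sum_shift sum_shift2.
    under eq_bigr do rewrite /linform sum_shift -/(linform _ _).
    over.
  have d1 := is_derive_affine (\sum_j g j * c j) (g i) t.
  have d2 := is_derive_quadratic (eps / 2) (\sum_j c j ^+ 2) (c i *+ 2) t.
  have d3 := @is_derive_fsum R E _ _ t (fun e => is_derive_cstM (k e)%:R _ _ _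
    (@is_derive_ln_bernoulli_mgf R s hs (linform c e) (A e i) t)).
  apply: (is_derive_eq (is_deriveD (is_deriveB d3 d1) d2)).
  by congr (_ + _); field.
have h0 : ridge eps (shift c i 0) = ridge eps c.
  by congr ridge; apply/funext => j; rewrite /shift mul0r addr0.
have /@derive_val : is_derive (0:R) 1 (fun t => ridge eps (shift c i t)) 0.
  apply: (@derive1_at_min R _ (-1) 1).
  - by rewrite (@le_trans _ _ 0).
  - by move=> t _; exact: ex_derive.
  - by rewrite in_itv/= ltrN10 ltr01.
  - by move=> t _; rewrite h0.
rewrite (@derive_val _ _ _ _ _ _ _ (dphi 0)) addr0.
have -> : marginal (tilting c) i = \sum_e (k e)%:R *
    (A e i * (s * expR (linform c e + 0 * A e i) /
      bernoulli_mgf s (linform c e + 0 * A e i))).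
  by apply: eq_bigr => e _; rewrite mul0r addr0 mulrCA.
lra.
Qed.

Lemma ridge_has_min eps L : 0 < eps -> (forall c, L <= log_potential c) ->
  exists c, forall c', ridge eps c <= ridge eps c'.
Proof.
move=> e0 hL; pose D := log_potential (fun=> 0) - L.
have D0 : 0 <= D by rewrite subr_ge0.
(* Chosen so that [eps / 2 * B ^+ 2 = D]: outside the box of radius [B] the penalty alone is at
   least [D], so the ridge is at least [L + D], its value at 0. *)
pose B := Num.sqrt (2 * D / eps).
have B0 : 0 <= B by exact: sqrtr_ge0.
have [i|c cB minc] := @box_EVT_min R I (fun=> - B) (fun=> B) (ridge eps) _
  (continuous_ridge eps); first by rewrite (le_trans _ B0)// oppr_le0.
exists c => c'.
have [c'B|] := pselect (forall i, - B <= c' i <= B); first exact: minc.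
move=> /existsNP[i /negP nB].
have r0 : ridge eps (fun=> 0) = L + D.
  rewrite /ridge big1 => [|j _]; last by rewrite expr0n.
  by rewrite mulr0 addr0 /D addrC subrK.
apply: (@le_trans _ _ (L + D)).
  by rewrite -r0; apply: minc => j; rewrite B0 oppr_le0 B0.
apply: lerD => //.
have hB : B ^+ 2 <= c' i ^+ 2.
  rewrite -[leRHS]real_normK ?num_real// lerXn2r ?nnegrE//.
  by rewrite leNgt ltr_norml; apply: contra nB => /andP[/ltW-> /ltW->].
have -> : D = eps / 2 * B ^+ 2.
  rewrite sqr_sqrtr; last by rewrite divr_ge0 ?mulr_ge0// ltW.
  by field; exact: lt0r_neq0.
rewrite ler_pM2l ?divr_gt0// (le_trans hB)//.
by rewrite (bigD1 i)//= lerDl sumr_ge0// => j _; exact: sqr_ge0.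
Qed.

(* At a minimiser [c] of the ridge-penalised potential the marginals of the
   tilting miss [g] by [eps * c i], while [L] bounds [eps * c i ^+ 2]. *)
Lemma approx_dual L eps : 0 < eps -> (forall c, L <= log_potential c) ->
  exists M, [/\ forall e, factor_dom s (k e)%:R (M e),
    L <= entropy M &
    \sum_i (marginal M i - g i) ^+ 2 <= eps * (2 * (log_potential (fun=> 0) - L))].
Proof.
move=> e0 hL; have [c minc] := ridge_has_min eps L e0 hL.
exists (tilting c); have mE := ridge_min_critical eps c minc; split.
- by move=> e; exact: tilted_mean_dom.
(* By criticality each term of the correction is [eps * c i ^+ 2], hence nonnegative. *)
- rewrite entropy_tilting (le_trans (hL c))// lerDl sumr_ge0// => i _.
  rewrite mE opprB addrC subrK -mulrA -expr2.
  by rewrite mulr_ge0 ?sqr_ge0// ltW.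
- have -> : \sum_i (marginal (tilting c) i - g i) ^+ 2 =
     eps * (eps * \sum_i c i ^+ 2).
    rewrite !mulr_sumr; apply: eq_bigr => i _; rewrite mE; ring.
  (* Comparing the ridge at [c] and at 0 bounds [eps / 2] times the squared norm of [c] by
     [log_potential (fun=> 0) - L]. *)
  rewrite ler_pM2l//; have := minc (fun=> 0); have := hL c.
  rewrite /ridge [X in _ <= _ + _ * X]big1 => [|j _]; last by rewrite expr0n.
  lra.
Qed.

Lemma continuous_factor_entropy a : continuous (factor_entropy s a).
Proof.
move=> m; apply: cvgB; last first.
  apply: (@continuous_comp _ _ _ (fun m => a - m) (fun x => x * ln x)).
    by apply: cvgB; [exact: cvg_cst|exact: cvg_id].
  exact: continuous_mul_ln.
apply: cvgB; last exact: continuous_mul_ln.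
apply: cvgD; last first.
  by apply: cvgMr_tmp; apply: cvgB; [exact: cvg_cst|exact: cvg_id].
by apply: cvgD; [exact: cvg_cst|apply: cvgMr_tmp; exact: cvg_id].
Qed.

(* [factor_dom] is an interval, so minimising over boxes covers [s = 0] and
   [s = 1], where the factor itself is discontinuous in [m]. *)
Lemma factor_domP a m : 0 <= a ->
  factor_dom s a m <-> a * (s == 1)%:R <= m <= a * (s != 0)%:R.
Proof.
move=> a0; split.
  case=> m0 ma s0 s1; apply/andP; split.
    by case: eqP => [/s1->|]; rewrite ?mulr1 ?mulr0.
  by case: eqP => [/s0->|]/=; rewrite ?mulr1 ?mulr0.
move=> /andP[lo hi]; split.
- by apply: le_trans lo; rewrite mulr_ge0.
- by apply: le_trans hi _; rewrite ler_piMr// lern1 leq_b1.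
- move=> s0; apply/eqP; rewrite eq_le; move: lo hi; rewrite s0 eqxx/= mulr0.
  by rewrite eq_sym oner_eq0 mulr0 => -> ->.
- move=> s1; apply/eqP; rewrite eq_le; move: lo hi; rewrite s1 eqxx.
  by rewrite oner_eq0 /= !mulr1 => -> ->.
Qed.

(* Minimising the total violation over the compact box replaces the extraction
   of a convergent subsequence of the approximate solutions. *)
Lemma strong_duality L : (forall c, L <= log_potential c) ->
  exists M, [/\ forall e, factor_dom s (k e)%:R (M e),
    forall i, marginal M i = g i & L <= entropy M].
Proof.
(* [V] is nonnegative and vanishes exactly when the marginals are [g] and the entropy is at least
   [L]. *)
move=> hL; pose V M := \sum_i (marginal M i - g i) ^+ 2
  + Num.max 0 (L - entropy M).
have cV : continuous (V : coord_space E -> R).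
  have cproj e : continuous (fun M : coord_space E => M e).
    exact: (@proj_continuous E (fun=> R) e).
  have cmarg i : continuous (fun M : coord_space E => marginal M i).
    exact (@continuous_fsum R (coord_space E) E (fun e M => A e i * M e)
      (fun e => @continuous_cstM R (coord_space E) (A e i) _ (cproj e))).
  have cviol := @continuous_fsum R (coord_space E) I
    (fun i M => (marginal M i - g i) ^+ 2)
    (fun i => @continuous_sqr R (coord_space E) _
      (@continuous_subf R (coord_space E) _ _ (cmarg i)
        (fun M => @cst_continuous (coord_space E) R (g i) M))).
  have cfac e : continuous (fun M : coord_space E =>
      factor_entropy s (k e)%:R (M e)).
    move=> M; apply: (@continuous_comp _ _ _
      (fun M : coord_space E => M e) (factor_entropy s _)).
      exact: cproj.
    exact: continuous_factor_entropy.
  have cent := @continuous_subf R (coord_space E) _ _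
    (fun M => @cst_continuous (coord_space E) R L M)
    (@continuous_fsum R (coord_space E) E _ cfac).
  exact (@continuous_addf R (coord_space E) _ _ cviol
    (fun M => @continuous_max R (coord_space E) (cst 0) _ M
      (@cst_continuous (coord_space E) R 0 M) (cent M))).
have [e|M boxM minM] := @box_EVT_min R E (fun e => (k e)%:R * (s == 1)%:R)
    (fun e => (k e)%:R * (s != 0)%:R) V _ cV.
  by rewrite ler_wpM2l// ler_nat; case: eqP => // ->; rewrite oner_eq0.
have sq0 M' : 0 <= \sum_i (marginal M' i - g i) ^+ 2.
  by rewrite sumr_ge0// => i _; exact: sqr_ge0.
have VM : V M <= 0.
  pose D := 2 * (log_potential (fun=> 0) - L).
  have D0 : 0 <= D by rewrite mulr_ge0// subr_ge0.
  apply/ler_addgt0Pr => d d0; rewrite add0r.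
  (* This makes the error bound [d * D / (D + 1) <= d]; the added 1 covers [D = 0]. *)
  have [|M' [domM' LM' sM']] := approx_dual L (d / (D + 1)) _ hL.
    by rewrite divr_gt0// ltr_wpDl.
  apply: (le_trans (minM M' _)).
    by move=> e; apply/factor_domP.
  rewrite /V max_l ?subr_le0// addr0 (le_trans sM')//.
  rewrite -/D mulrAC ler_pdivrMr ?ltr_wpDl// ler_pM2l// lerDl.
  exact: ler01.
have m0 : 0 <= Num.max 0 (L - entropy M) by rewrite le_max lexx.
have [sM0 eM0] : \sum_i (marginal M i - g i) ^+ 2 = 0 /\
    Num.max 0 (L - entropy M) = 0.
  by move: VM (sq0 M); rewrite /V => *; split; lra.
exists M; split.
- by move=> e; apply/factor_domP.
- move=> i; apply/eqP; rewrite -subr_eq0 -sqrf_eq0.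
  move/eqP: sM0; rewrite psumr_eq0 => [|j _]; last exact: sqr_ge0.
  by move=> /allP/(_ i); rewrite mem_index_enum => /(_ isT).
- by rewrite -subr_le0 -eM0 le_max lexx orbT.
Qed.

End Duality.

(** * Specialisation to matrices with given row and column sums *)

Section Matrices.
Context {R : realType} {m n : nat}.
Variables (alpha : 'rV[nat]_m) (beta : 'rV[nat]_n) (K : 'M[nat]_(m, n)).
Context {s : R} (hs : 0 <= s <= 1).

(** Matrix entries are the edges of the complete bipartite graph on rows and columns; marginals at
    its vertices are the line sums. *)
Definition incidence (e : 'I_m * 'I_n) (v : 'I_m + 'I_n) : R :=
  match v with inl i => (i == e.1)%:R | inr j => (j == e.2)%:R end.

Definition line_sum (v : 'I_m + 'I_n) : R :=
  match v with inl i => (alpha ord0 i)%:R | inr j => (beta ord0 j)%:R end.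

Definition multiplicity (e : 'I_m * 'I_n) := K e.1 e.2.

Definition cap_potential :=
  log_potential (s := s) incidence multiplicity line_sum.

Let sum_indic (J : finType) (i : J) (F : J -> R) :
  \sum_j (j == i)%:R * F j = F i.
Proof.
by rewrite (bigD1 i)//= eqxx mul1r big1 ?addr0// => j /negPf->; rewrite mul0r.
Qed.

Let sum_pair (F : 'I_m * 'I_n -> R) : \sum_e F e = \sum_i \sum_j F (i, j).
Proof. by rewrite pair_bigA/=; apply: eq_bigr => -[]. Qed.

Lemma linform_incidence c e :
  linform incidence c e = c (inl e.1) + c (inr e.2).
Proof. by rewrite /linform big_sumType/= !sum_indic. Qed.

Lemma marginal_row M i : marginal incidence M (inl i) = \sum_j M (i, j).
Proof.
rewrite /marginal sum_pair.
rewrite /= -[RHS](sum_indic _ i (fun i' => \sum_j M (i', j))).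
by apply: eq_bigr => i' _; rewrite mulr_sumr eq_sym.
Qed.

Lemma marginal_col M j : marginal incidence M (inr j) = \sum_i M (i, j).
Proof.
rewrite /marginal sum_pair.
rewrite /=; apply: eq_bigr => i _.
rewrite -[RHS](sum_indic _ j (fun j' => M (i, j'))).
by apply: eq_bigr => j' _; rewrite eq_sym.
Qed.

Lemma objectiveE (M : 'M[R]_(m, n)) :
  objective K s M = \prod_e cap_factor s (multiplicity e) (M e.1 e.2).
Proof. by rewrite /objective pair_bigA. Qed.

Let expV_expR (k : nat) (c : R) : expR c ^- k = expR (- (k%:R * c)).
Proof. by rewrite expRN expRM_natl. Qed.

Lemma cap_integrand_expR (x : 'rV[R]_m) (y : 'rV[R]_n) c :
  (forall i, x ord0 i = expR (c (inl i))) ->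
  (forall j, y ord0 j = expR (c (inr j))) ->
  Q K s x y * \prod_(i < m) x ord0 i ^- alpha ord0 i
            * \prod_(j < n) y ord0 j ^- beta ord0 j =
  expR (cap_potential c).
Proof.
move=> xE yE; rewrite /cap_potential /log_potential big_sumType/=.
rewrite opprD addrA -!sumrN !expRD !expR_sum; congr (_ * _ * _).
- rewrite /Q pair_bigA/=; apply: eq_bigr => e _.
  rewrite expRM_natl lnK ?posrE ?bernoulli_mgf_gt0//.
  by rewrite linform_incidence /bernoulli_mgf expRD xE yE.
- by apply: eq_bigr => i _; rewrite xE expV_expR.
- by apply: eq_bigr => j _; rewrite yE expV_expR.
Qed.

(** Every positive vector is the exponential of its logarithm, so both infima range over the same
    values. *)
Lemma capacityE :
  capacity alpha beta (Q K s) = inf (range (expR \o cap_potential)).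
Proof.
rewrite /capacity; congr inf; apply/seteqP; split => [z /= [x [y [x0 y0 ->]]]|z /=].
  pose c v := match v with inl i => ln (x ord0 i) | inr j => ln (y ord0 j) end.
  exists c => //; rewrite (cap_integrand_expR x y c)// => i;
    by rewrite lnK// posrE.
case=> c _ <-; exists (\row_i expR (c (inl i))), (\row_j expR (c (inr j))).
split; [by move=> i; rewrite mxE expR_gt0|by move=> i; rewrite mxE expR_gt0|].
by rewrite (cap_integrand_expR _ _ c)// => i; rewrite mxE.
Qed.

End Matrices.

(* The objective is nonnegative and bounded on the feasible set; if that set is
   empty, [sup] is 0, the supremum of the empty set among nonnegative reals. *)
Theorem theorem3p2 (R : realType) (m n : nat)
    (alpha : 'rV[nat]_m) (beta : 'rV[nat]_n) (K : 'M[nat]_(m, n)) (s : R)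
    (hs : 0 <= s <= 1) :
  capacity alpha beta (Q K s) = sup (objective K s @` feasible K alpha beta).
Proof.
rewrite (capacityE alpha beta K hs); set S := range _; set T := _ @` _.
have S0 : S !=set0 by eexists; exists (fun=> 0).
have Slb : lbound S 0 by move=> _ [c _ <-]; exact: expR_ge0.
have infS_ge0 : 0 <= inf S by exact: lb_le_inf.
(* Weak duality, which gives the supremum at most the infimum. *)
have TS : ubound T (inf S).
  move=> _ [M [boxM rowM colM] <-]; apply: lb_le_inf => // _ [c _ <-].
  rewrite objectiveE; apply: (@prod_factor_le R _ _ s hs incidence
    (multiplicity K) (line_sum alpha beta) (fun e => M e.1 e.2) c).
  - by move=> e; exact: boxM.
  - by case=> [i|j] /=; rewrite ?marginal_row ?marginal_col/= ?rowM ?colM.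
have T_ge0 z : T z -> 0 <= z.
  case=> M _ <-; rewrite objectiveE; apply: prodr_ge0 => e _; exact: cap_factor_ge0.
apply/eqP; rewrite eq_le; apply/andP; split; last first.
  have [->|/set0P T0] := eqVneq T set0; first by rewrite sup0.
  exact: sup_le_ub.
(* A zero infimum needs only a nonnegative supremum, with [sup set0 = 0] in the empty case. A
   positive one has a logarithm that bounds the potential from below, as strong duality requires. *)
have [infS0|infS_gt0] := leP (inf S) 0.
  apply: (le_trans infS0).
  have [->|/set0P[z Tz]] := eqVneq T set0; first by rewrite sup0.
  apply: (le_trans (T_ge0 z Tz)); apply: ub_le_sup => //.
  by exists (inf S).
have [c|M [domM margM entM]] := strong_duality hs incidence (multiplicity K)
    (line_sum alpha beta) (ln (inf S)) _.
  rewrite -ler_expR lnK ?posrE//; apply: ge_inf; first by exists 0.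
  by exists c.
pose M' := \matrix_(i, j) M (i, j) : 'M[R]_(m, n).
have TM : T (objective K s M').
  exists M' => //; split.
  - by move=> i j; rewrite mxE; have [-> -> _ _] := domM (i, j).
  - by move=> i; under eq_bigr do rewrite mxE; rewrite -marginal_row margM.
  - by move=> j; under eq_bigr do rewrite mxE; rewrite -marginal_col margM.
apply: (@le_trans _ _ (objective K s M')); last first.
  by apply: ub_le_sup => //; exists (inf S).
rewrite -[leLHS]lnK ?posrE// objectiveE.
rewrite (eq_bigr (fun e => expR (factor_entropy s (multiplicity K e)%:R (M e)))).
  by rewrite -expR_sum ler_expR.
by move=> [i j] _; rewrite mxE cap_factorE//; exact: domM (i, j).
Qed.
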